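(* Let $\mathbf{X}$, $\mathbf{Y}$ and $\mathbf{Z}$ be disjoint node sets in a causal DAG $\mathcal{D}$. Then $\mathbf{Z}$ is a valid adjustment set relative to $(\mathbf{X},\mathbf{Y})$ in $\mathcal{D}$ if and only if $\mathbf{Z}$ is also a valid adjustment set relative to $(\mathbf{X},\mathbf{Y})$ in the forbidden projection $\mathcal{D}^{\mathbf{XY}}$.
   Context: Graph terminology. All graphs are loop-free; an acyclic directed mixed graph (ADMG) has directed ($\rightarrow$) and bi-directed ($\leftrightarrow$) edges and no directed cycles; two nodes may be joined by both a directed and a bi-directed edge. A path is a sequence of distinct nodes together with edges joining consecutive nodes. A path from $\mathbf{X}$ to $\mathbf{Y}$ has first node in $\mathbf{X}$ and last node in $\mathbf{Y}$; it is proper if only its first node is in $\mathbf{X}$. It is causal (directed) if all its edges are directed edges pointing towards the last node, otherwise non-causal. In a graph $\mathcal{G}$, $\mathrm{de}(V,\mathcal{G})$ / $\mathrm{an}(V,\mathcal{G})$ are the descendants / ancestors of $V$ via directed paths (including $V$); for node sets take unions. A non-endpoint node on a path is a collider if both adjoining path edges have an arrowhead at it, else a non-collider. A path is blocked by $\mathbf{C}$ if it contains a non-collider in $\mathbf{C}$ or a collider not in $\mathrm{an}(\mathbf{C},\mathcal{G})$. Causal nodes and forbidden nodes. For a DAG or ADMG $\mathcal{G}$, $\mathrm{cn}(\mathbf{X},\mathbf{Y},\mathcal{G})$ is the set of nodes on proper causal paths from $\mathbf{X}$ to $\mathbf{Y}$, excluding nodes in $\mathbf{X}$; $\mathrm{forb}(\mathbf{X},\mathbf{Y},\mathcal{G})=\mathrm{de}(\mathrm{cn}(\mathbf{X},\mathbf{Y},\mathcal{G}),\mathcal{G})\cup\mathbf{X}$.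 Latent projection. For a DAG $\mathcal{D}$ with node set $\mathbf{W}\cup\mathbf{L}$, $\mathbf{W}\cap\mathbf{L}=\emptyset$, the latent projection $\mathcal{D}(\mathbf{W})$ has node set $\mathbf{W}$ and, for distinct $W_i,W_j\in\mathbf{W}$: (1) an edge $W_i\rightarrow W_j$ iff $\mathcal{D}$ contains a directed path $W_i\rightarrow\dots\rightarrow W_j$ on which all non-endpoint nodes are in $\mathbf{L}$; (2) an edge $W_i\leftrightarrow W_j$ iff $\mathcal{D}$ contains a path, with at least one non-endpoint node, of the form $W_i\leftarrow\dots\rightarrow W_j$ on which all non-endpoint nodes are non-colliders and in $\mathbf{L}$. Forbidden projection. For a DAG $\mathcal{D}$ with node set $\mathbf{V}$, $\mathcal{D}^{\mathbf{XY}}=\mathcal{D}((\mathbf{V}\setminus\mathrm{forb}(\mathbf{X},\mathbf{Y},\mathcal{D}))\cup\mathbf{X}\cup\mathbf{Y})$; it is an ADMG. Valid adjustment sets. A (possibly empty) set $\mathbf{Z}$ is a valid adjustment set relative to $(\mathbf{X},\mathbf{Y})$ in a causal DAG or causal ADMG (latent projection of a causal DAG) $\mathcal{G}$ if $\mathbf{Z}$ is a set of nodes of $\mathcal{G}$ disjoint from $\mathbf{X}\cup\mathbf{Y}$ and, for every joint density compatible with $\mathcal{G}$, $f(\mathbf{y}\mid do(\mathbf{x}))$ equals $f(\mathbf{y}\mid\mathbf{x})$ if $\mathbf{Z}=\emptyset$ and $\int f(\mathbf{y}\mid\mathbf{x},\mathbf{z})f(\mathbf{z})\,d\mathbf{z}$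 otherwise. By the known generalised adjustment criterion this is equivalent to the following graphical condition, which may be taken as the definition: $\mathbf{Z}\cap\mathrm{forb}(\mathbf{X},\mathbf{Y},\mathcal{G})=\emptyset$, and every proper non-causal path from $\mathbf{X}$ to $\mathbf{Y}$ in $\mathcal{G}$ is blocked by $\mathbf{Z}$. *)

(* Defs.v *)
From mathcomp Require Import all_boot.
From mathcomp Require Import boolp.

Set Implicit Arguments.
Unset Strict Implicit.
Unset Printing Implicit Defensive.

(* The nodes are a subset of an ambient finite type, so that a graph and its
   latent projections live over the same type and share their node names. *)
Record mixed_graph (T : finType) := MixedGraph {
  nodes : {set T};
  dir : rel T; (* dir G u v is u -> v *)
  bid : rel T  (* bid G u v is u <-> v *)
}.

(* The acyclicity clause also rules out directed loops u -> u, because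
   connect is reflexive. *)
Definition is_admg (T : finType) (G : mixed_graph T) : Prop :=
  [/\ forall u v, dir G u v || bid G u v -> (u \in nodes G) && (v \in nodes G),
      irreflexive (bid G),
      symmetric (bid G) &
      forall u v, dir G u v -> ~~ connect (dir G) v u].

Definition is_dag (T : finType) (G : mixed_graph T) : Prop :=
  is_admg G /\ forall u v, ~~ bid G u v.

(* The way in which the edge used by one step of a path is traversed:
   Fwd is u -> v, Bwd is u <- v and Bi is u <-> v, for a step from u to v. *)
Inductive mark := Fwd | Bwd | Bi.

Definition is_fwd (k : mark) : bool := if k is Fwd then true else false.
Definition head_at_source (k : mark) : bool := if k is Fwd then false else true.
Definition head_at_target (k : mark) : bool := if k is Bwd then false else true.

Definition has_edge (T : finType) (G : mixed_graph T) (k : mark) (u v : T) :=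
  match k with
  | Fwd => dir G u v
  | Bwd => dir G v u
  | Bi => bid G u v
  end.

(* Two nodes may be joined by several edges, so a path records its edges: it is
   given by its first node x and a sequence p of steps (k, v), where v is the
   node reached and k says which edge is used to reach it. *)
Fixpoint is_walk (T : finType) (G : mixed_graph T) (x : T)
    (p : seq (mark * T)) : bool :=
  if p is (k, v) :: p' then has_edge G k x v && is_walk G v p' else true.

Definition is_path (T : finType) (G : mixed_graph T) (x y : T)
    (p : seq (mark * T)) : bool :=
  [&& x \in nodes G, is_walk G x p, uniq (x :: unzip2 p)
    & last x (unzip2 p) == y].

Definition is_causal (T : finType) (p : seq (mark * T)) : bool :=
  all (fun s => is_fwd s.1) p.

Definition is_proper_path (T : finType) (G : mixed_graph T) (X Y : {set T})
    (x y : T) (p : seq (mark * T)) : bool :=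
  [&& is_path G x y p, x \in X, y \in Y
    & all (fun v => v \notin X) (unzip2 p)].

(* One entry (s, t) for each non-endpoint node of the path: s is the step that
   enters the node s.2, and t the step that leaves it. *)
Definition inner (T : finType) (p : seq (mark * T)) :
    seq ((mark * T) * (mark * T)) :=
  zip p (behead p).

Definition collider (T : finType) (st : (mark * T) * (mark * T)) : bool :=
  head_at_target st.1.1 && head_at_source st.2.1.

Definition de (T : finType) (G : mixed_graph T) (C : {set T}) : {set T} :=
  [set v | [exists c in C, connect (dir G) c v]].

Definition an (T : finType) (G : mixed_graph T) (C : {set T}) : {set T} :=
  [set v | [exists c in C, connect (dir G) v c]].

Definition blocked (T : finType) (G : mixed_graph T) (C : {set T})
    (p : seq (mark * T)) : bool :=
  has (fun st => if collider st then st.1.2 \notin an G C else st.1.2 \in C)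
      (inner p).

Definition cn (T : finType) (G : mixed_graph T) (X Y : {set T}) : {set T} :=
  [set v | `[< exists x y p, [/\ is_proper_path G X Y x y p, is_causal p
                               & v \in x :: unzip2 p] >]] :\: X.

Definition forb (T : finType) (G : mixed_graph T) (X Y : {set T}) : {set T} :=
  de G (cn G X Y) :|: X.

Definition latent_projection (T : finType) (D : mixed_graph T)
    (W : {set T}) : mixed_graph T :=
  let L := nodes D :\: W in
  {| nodes := W;
     dir := fun u v => [&& u \in W, v \in W, u != v &
       `[< exists p, [/\ is_path D u v p, is_causal p &
                         all (fun st => st.1.2 \in L) (inner p)] >]];
     bid := fun u v => [&& u \in W, v \in W, u != v &
       `[< exists s p t,
             let q := s :: rcons p t in
             [/\ is_path D u v q, s.1 = Bwd, t.1 = Fwd &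
                 all (fun st => ~~ collider st && (st.1.2 \in L)) (inner q)]
         >]] |}.

Definition forbidden_projection (T : finType) (D : mixed_graph T)
    (X Y : {set T}) : mixed_graph T :=
  latent_projection D ((nodes D :\: forb D X Y) :|: X :|: Y).

(* Validity is taken in the form of the generalised adjustment criterion, which
   is equivalent to the identity of f(y | do(x)) with the adjustment formula
   for Z for every joint density compatible with G. *)
Definition valid_adjustment_set (T : finType) (G : mixed_graph T)
    (X Y Z : {set T}) : Prop :=
  [/\ Z \subset nodes G,
      [disjoint Z & X :|: Y],
      [disjoint Z & forb G X Y] &
      forall x y p, is_proper_path G X Y x y p -> ~~ is_causal p ->
        blocked G Z p].

(* Main.v *)
Require Import Defs.
From mathcomp Require Import all_boot.
From mathcomp Require Import boolp.

(** Write W for the nodes kept by the forbidden projection D^XY and L for the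
    latent ones.  Every latent node lies in de(cn(X, Y)), a set closed under
    descendants.  As soon as Z avoids the forbidden nodes, no node of de(cn) is
    an ancestor of Z; and both notions of validity force Z to avoid them: in D
    by definition, in D^XY because Z is made of kept nodes outside X and Y.
    Projecting preserves ancestry between kept nodes ([latent_connect]) and
    creates no new forbidden node ([latent_forb_sub]).  It remains to compare
    the open proper non-causal paths of the two graphs.

    From D to D^XY.  On an open path of D a latent node is never a collider,
    since it is not an ancestor of Z.  The path therefore splits at its kept
    nodes into pieces without colliders and with latent interior, and each
    piece is exactly what gives rise to an edge of the projection, with the
    same arrowheads at its two ends ([project_walk]).  Being open and being
    non-causal are both preserved.

    From D^XY to D.  Replacing each edge by a piece of D from which it arises
    gives an open, proper, non-causal walk ([lift_walk]), which may repeat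
    nodes.  Cutting out its loops one at a time could produce a causal path,
    but not here ([open_walk_shorten]): if the result were causal, the node v
    at which the loop is cut would lie in cn and be entered by an arrowhead.  A
    walk entering v by an arrowhead and not causal from there on meets, after
    some directed edges, a collider, which is open; so v would be an ancestor
    of Z ([open_noncausal_an]), which no node of cn is.  The walk was thus
    causal before the cut. *)

Set Implicit Arguments.
Unset Strict Implicit.
Unset Printing Implicit Defensive.

(** * Conditions on the inner nodes of a sequence of steps *)
Section Marks.
Variable T : finType.
Implicit Types (P : T -> bool -> bool) (s t : mark * T) (p q r : seq (mark * T)).

(** A condition on each inner node and its collider status, as a relation
    between consecutive steps.  Expressing it with [path] and [sorted] makes it
    compatible with concatenation. *)
Definition inner_ok P : rel (mark * T) := fun s t => P s.2 (collider (s, t)).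

Definition noncollider_in (L : {set T}) : T -> bool -> bool :=
  fun v c => ~~ c && (v \in L).

Definition open_at (G : mixed_graph T) (Z : {set T}) : T -> bool -> bool :=
  fun v c => if c then v \in an G Z else v \notin Z.

Lemma all_inner (A : pred ((mark * T) * (mark * T))) p :
  all A (inner p) = sorted (fun s t => A (s, t)) p.
Proof.
by rewrite /inner; case: p => //= s p; elim: p s => //= t p IH s; rewrite IH.
Qed.

Lemma unblockedE G Z p : ~~ blocked G Z p = sorted (inner_ok (open_at G Z)) p.
Proof.
rewrite /blocked -all_predC all_inner; apply: eq_sorted => s t /=.
by rewrite /inner_ok /open_at /=; case: ifP; rewrite ?negbK.
Qed.

Lemma path_source (A : pred T) s r :
  path (fun s _ => A s.2) s r = all A (unzip2 (belast s r)).
Proof. by elim: r s => //= t r IH s; rewrite IH. Qed.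

Lemma is_fwdE (k : mark) : is_fwd k = ~~ head_at_source k.
Proof. by case: k. Qed.

(** Without colliders, an edge that points forward can only be followed by an
    edge that points forward, so the first edge decides. *)
Lemma noncollider_chain_causal s r :
  path (inner_ok (fun _ c => ~~ c)) s r -> is_causal (s :: r) = is_fwd s.1.
Proof.
rewrite /is_causal; elim: r s => [|t r IH] s /=; first by rewrite andbT.
case/andP=> st /IH /= ->; move: st.
by rewrite /inner_ok /collider; case: s.1; case: t.1.
Qed.

(** The mirror image: without colliders, a final backward edge can only be
    preceded by backward edges. *)
Lemma noncollider_chain_bwd s r :
  path (inner_ok (fun _ c => ~~ c)) s r -> ~~ head_at_target (last s r).1 ->
  s :: r = map (pair Bwd) (unzip2 (s :: r)).
Proof.
elim: r s => [|t r IH] s /=; first by case: s => [[]].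
case/andP=> st tr /(IH _ tr) /= [tE rE]; rewrite -rE -tE; move: st.
by rewrite tE /inner_ok /collider /=; case: s => [[]].
Qed.

Lemma causal_steps p : is_causal p -> p = map (pair Fwd) (unzip2 p).
Proof. by elim: p => //= -[[] v] p IH //= /IH <-. Qed.

Lemma unzip2_steps (k : mark) (l : seq T) : unzip2 (map (pair k) l) = l.
Proof. by elim: l => //= v l ->. Qed.

Lemma unzip2_cat p q : unzip2 (p ++ q) = unzip2 p ++ unzip2 q.
Proof. exact: map_cat. Qed.

Lemma unzip2_rcons p s : unzip2 (rcons p s) = rcons (unzip2 p) s.2.
Proof. exact: map_rcons. Qed.

Lemma causal_of_steps (l : seq T) : is_causal (map (pair Fwd) l).
Proof. by elim: l. Qed.

Lemma causal_cat p q : is_causal (p ++ q) = is_causal p && is_causal q.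
Proof. exact: all_cat. Qed.

Lemma split_first (A : pred T) s r : A (last s r).2 ->
  exists r1 r2, [/\ r = r1 ++ r2, A (last s r1).2 &
                    path (fun s _ => ~~ A s.2) s r1].
Proof.
elim: r s => [|t r IH] s /=; first by exists [::], [::].
have [As _|As] := boolP (A s.2); first by exists [::], (t :: r).
by case/IH=> r1 [r2 [-> Al tr1]]; exists (t :: r1), r2; rewrite /= As.
Qed.

Lemma not_uniqP p : ~~ uniq (unzip2 p) ->
  exists a s b t c, p = a ++ s :: b ++ t :: c /\ s.2 = t.2.
Proof.
elim: p => //= s p IH; rewrite negb_and negbK => /orP[|].
  move=> sp; suff [b [t [c [-> e]]]] : exists b t c, p = b ++ t :: c /\ s.2 = t.2.
    by exists [::], s, b, t, c.
  elim: p sp {IH} => //= t p IH; rewrite inE; case: eqP => [e _|_ /IH].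
    by exists [::], t, p.
  by case=> b [t' [c [-> e]]]; exists (t :: b), t', c.
by case/IH=> a [s' [b [t [c [-> e]]]]]; exists (s :: a), s', b, t, c.
Qed.

End Marks.

(** * Walks in a mixed graph *)
Section Walks.
Variables (T : finType) (G : mixed_graph T).
Implicit Types (x u v : T) (p q r : seq (mark * T)).

Lemma is_walk_cat x p q :
  is_walk G x (p ++ q) = is_walk G x p && is_walk G (last x (unzip2 p)) q.
Proof. by elim: p x => //= -[k v] p IH x; rewrite IH /= andbA. Qed.

Lemma is_walk_fwd x l : is_walk G x (map (pair Fwd) l) = path (dir G) x l.
Proof. by elim: l x => //= v l IH x; rewrite IH. Qed.

Lemma is_walk_bwd x l :
  is_walk G x (map (pair Bwd) l) = path (fun a b => dir G b a) x l.
Proof. by elim: l x => //= v l IH x; rewrite IH. Qed.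

Lemma causal_walk_path x p :
  is_walk G x p -> is_causal p -> path (dir G) x (unzip2 p).
Proof. by move=> + /causal_steps pE; rewrite {1}pE is_walk_fwd. Qed.

Lemma walk_nodes x p : is_admg G -> is_walk G x p ->
  all [in nodes G] (unzip2 p).
Proof.
case=> Gn _ _ _; elim: p x => //= -[k v] p IH x /andP[e /IH ->].
rewrite andbT; have: (dir G x v || bid G x v) || dir G v x.
  by case: k e => /= ->; rewrite ?orbT.
by case/orP=> [/Gn/andP[]//|vx]; have := Gn v x; rewrite vx => /(_ isT)/andP[].
Qed.

Lemma acyclic_path_uniq x l :
  (forall u v, dir G u v -> ~~ connect (dir G) v u) ->
  path (dir G) x l -> uniq (x :: l).
Proof.
move=> acG xl.
pose lt u v := connect (dir G) u v && ~~ connect (dir G) v u.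
apply: (@sorted_uniq _ lt).
- move=> b a c /andP[ab ba] /andP[bc cb]; rewrite /lt (connect_trans ab bc).
  by apply: contra cb => ca; apply: connect_trans ca ab.
- by move=> a; rewrite /lt connect0.
by apply: sub_path xl => a b ab; rewrite /lt connect1 //= acG.
Qed.

(** From a node entered by an arrowhead, the first edge that is not directed
    forward creates a collider.  All edges before it are directed forward, so
    that collider is a descendant of the node, and openness makes it an ancestor
    of Z. *)
Lemma open_noncausal_an (Z : {set T}) s p :
  path (inner_ok (open_at G Z)) s p -> is_walk G s.2 p ->
  head_at_target s.1 -> ~~ is_causal p -> s.2 \in an G Z.
Proof.
elim: p s => //= -[k w] p IH s /andP[sw wp] /andP[e walk] hs.
move: sw; rewrite /inner_ok /open_at /collider /= hs /=.
case: k e wp => //= e wp _ nc.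
have := IH _ wp walk isT nc; rewrite !inE => /exists_inP[z zZ wz].
by apply/exists_inP; exists z => //; apply: connect_trans wz; apply: connect1.
Qed.

End Walks.

(** * Cutting the loops of an open walk *)
Section Shorten.
Variables (T : finType) (D : mixed_graph T) (X Y Z : {set T}).
Hypothesis admgD : is_admg D.

Lemma de_an_disjoint v : [disjoint Z & forb D X Y] ->
  v \in de D (cn D X Y) -> v \notin an D Z.
Proof.
move=> ZF; rewrite !inE => /exists_inP[c cC cv]; apply/negP.
case/exists_inP=> z zZ vz.
suff zF : z \in forb D X Y by rewrite (disjointFr ZF zZ) in zF.
rewrite 2!inE; apply/orP; left; apply/exists_inP; exists c => //.
exact: connect_trans vz.
Qed.

Lemma causal_walk_cn x p v : x \in X -> x \in nodes D ->
  is_walk D x p -> is_causal p -> last x (unzip2 p) \in Y ->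
  all [predC X] (unzip2 p) -> v \in unzip2 p -> v \in cn D X Y.
Proof.
move=> xX xD walk caus lY pX vp; rewrite in_setD inE; have /= -> := allP pX _ vp.
apply/asboolP; exists x, (last x (unzip2 p)), p; split=> //.
  apply/and4P; split=> //; apply/and4P; split=> //.
  case: admgD => _ _ _ acD.
  by apply: (acyclic_path_uniq acD); apply: causal_walk_path.
by rewrite inE vp orbT.
Qed.

(** The loop between two visits of a node v is removed, keeping the step that
    enters v at the first visit and the step that leaves it at the second.  If v
    becomes a collider, the original walk is not causal after the first visit,
    and [open_noncausal_an] makes v an ancestor of Z; if v becomes a
    non-collider, it was already one at one of the two visits. *)
Lemma open_walk_shorten x y p :
  [disjoint Z & forb D X Y] ->
  x \in X -> x \in nodes D -> is_walk D x p ->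
  last x (unzip2 p) = y -> y \in Y ->
  all [predC X] (unzip2 p) -> ~~ is_causal p ->
  sorted (inner_ok (open_at D Z)) p ->
  exists q, [/\ is_proper_path D X Y x y q,
                ~~ is_causal q & ~~ blocked D Z q].
Proof.
move=> ZF xX xD + + yY; have [n] := ubnP (size p).
elim: n p => // n IH p; rewrite ltnS => sz walk ly pX nc op.
have [up|/not_uniqP] := boolP (uniq (unzip2 p)).
  exists p; split; rewrite ?unblockedE //.
  apply/and4P; split=> //.
  apply/and4P; split=> //=; last by rewrite ly.
  by rewrite up andbT; apply/negP => /(allP pX); rewrite /= xX.
case=> a [s [b [t [c [pE st]]]]]; subst p.
have lE : last x (unzip2 (a ++ s :: b ++ t :: c)) =
          last x (unzip2 (a ++ s :: c)).
  by rewrite !unzip2_cat /= unzip2_cat /= !last_cat /= last_cat /= st.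
move: ly; rewrite lE => ly.
have sE : s :: b ++ t :: c = [:: s] ++ (b ++ t :: c) by [].
have [aw ew] : is_walk D x (a ++ [:: s]) /\ is_walk D s.2 (b ++ t :: c).
  move: walk; rewrite sE (catA a) is_walk_cat => /andP[? ew]; split=> //.
  by move: ew; rewrite unzip2_cat last_cat.
have cw : is_walk D s.2 c.
  by move: ew; rewrite st -cat1s catA is_walk_cat unzip2_cat last_cat
     => /andP[].
have eo : path (inner_ok (open_at D Z)) s (b ++ t :: c).
  by case: {+}a op => [|d a'] //=; rewrite cat_path /= => /and3P[].
have w' : is_walk D x (a ++ s :: c).
  by rewrite -cat1s catA is_walk_cat aw unzip2_cat last_cat.
have X' : all [predC X] (unzip2 (a ++ s :: c)).
  apply/allP => v; rewrite unzip2_cat mem_cat /= inE => vin.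
  apply: (allP pX); rewrite unzip2_cat mem_cat /= inE unzip2_cat mem_cat /=.
  by rewrite inE; case/or3P: vin => ->; rewrite ?orbT.
(* Were the shorter walk causal, [s.2] would be in cn, hence no ancestor of Z,
   and the removed loop would have to be causal as well. *)
have nc' : ~~ is_causal (a ++ s :: c).
  apply: contra nc => caus.
  have scn : s.2 \in cn D X Y.
    apply: (causal_walk_cn xX xD w') => //; first by rewrite ly.
    by rewrite unzip2_cat mem_cat /= inE eqxx orbT.
  have sde : s.2 \in de D (cn D X Y).
    by rewrite inE; apply/exists_inP; exists s.2.
  have := caus; rewrite !causal_cat /= => /and3P[-> sF _] /=; rewrite sF /=.
  apply: contraR (de_an_disjoint ZF sde) => nce.
  by apply: (open_noncausal_an eo) => //; case: (s.1) sF.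
have o' : sorted (inner_ok (open_at D Z)) (a ++ s :: c).
  have sc : path (inner_ok (open_at D Z)) s c.
    case: c {pX op walk sz nc lE ly sE w' X' nc' aw} ew cw eo => [|d c] //=.
    move=> ew _ eo; have := eo; rewrite cat_path /= => /and4P[bs lbt td ->].
    rewrite andbT /inner_ok /open_at; case: ifPn => [|ncol].
      case/andP=> /= hs hd; apply: (open_noncausal_an eo) => //.
      by rewrite causal_cat /is_causal /= (is_fwdE d.1) hd /= !andbF.
    move: td; rewrite /inner_ok /open_at -st; case: ifPn => //.
    case/andP=> /= _ hd _.
    have hs : ~~ head_at_target s.1 by move: ncol; rewrite /collider /= hd andbT.
    by case: {+}b eo => [|e b'] /=; rewrite /inner_ok /open_at /collider (negPf hs)
       => /andP[].
  case: {+}a op => [|d a'] //=; rewrite !cat_path /= => /and3P[-> -> _].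
  by rewrite sc.
apply: (IH (a ++ s :: c)) => //.
by apply: leq_trans sz; rewrite !size_cat /= size_cat /= ltn_add2l !ltnS
   addnS ltnS leq_addl.
Qed.

End Shorten.

(** * Walks in a DAG and in its latent projection *)
Section Projection.
Variables (T : finType) (D : mixed_graph T) (W : {set T}).
Hypothesis dagD : is_dag D.
Hypothesis WD : W \subset nodes D.
Let L := nodes D :\: W.
Let G := latent_projection D W.

(** Acyclicity makes every directed walk a path.  In terms of [path], directed
    segments can be reversed with [rev_path]. *)
Lemma latent_dirP u v :
  dir G u v <-> [/\ u \in W, v \in W &
    exists2 r, path (dir D) u (rcons r v) & all [in L] r].
Proof.
case: (dagD) => [[Dn _ _ acD] _]; split.
  case/and4P=> uW vW uv /asboolP[p [/and4P[_ walk _ /eqP l] caus]].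
  rewrite all_inner => pL; split=> //.
  have up := causal_walk_path walk caus.
  case: p walk caus l pL up => [|s p] walk caus.
    by move=> /= uvE; rewrite uvE eqxx in uv.
  rewrite [s :: p]lastI unzip2_rcons last_rcons -lastI /= => l.
  rewrite path_source l => pL up; by exists (unzip2 (belast s p)).
case=> uW vW [r ur rL]; have ul := acyclic_path_uniq acD ur.
apply/and4P; split=> //.
  by move: ul; rewrite /= mem_rcons inE negb_or => /andP[/andP[]].
apply/asboolP; exists (map (pair Fwd) (rcons r v)); split.
- apply/and4P; split; first exact: (subsetP WD).
  + by rewrite is_walk_fwd.
  + by rewrite unzip2_steps.
  by rewrite unzip2_steps last_rcons.
- exact: causal_of_steps.
rewrite all_inner; case: r ur rL {ul} => //= a r _ rL.
by rewrite path_source map_rcons belast_rcons -map_cons unzip2_steps.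
Qed.

Lemma dir_latent_connect u v : dir G u v -> connect (dir D) u v.
Proof.
case/latent_dirP=> _ _ [r ur _]; apply/connectP; exists (rcons r v) => //.
by rewrite last_rcons.
Qed.

Lemma latent_edge_nodes k u v : has_edge G k u v -> (u \in W) && (v \in W).
Proof. by case: k => /= /and4P[-> ->]. Qed.

Lemma latent_walk_nodes x p : is_walk G x p -> all [in W] (unzip2 p).
Proof.
by elim: p x => //= -[k v] p IH x /andP[/latent_edge_nodes/andP[_ ->] /IH ->].
Qed.

(** The common form of the lifts of u -> v and of u <- v. *)
Lemma constant_segment u w j r :
  is_walk D u (map (pair j) (rcons r w)) -> all [in L] r ->
  ~~ (head_at_target j && head_at_source j) ->
  exists s r', [/\ is_walk D u (s :: r'), (last s r').2 = w,
    head_at_source s.1 = head_at_source j,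
    head_at_target (last s r').1 = head_at_target j &
    path (inner_ok (noncollider_in L)) s r'].
Proof.
case: r => [|a r] walk rL nj; first by exists (j, w), [::].
exists (j, a), (map (pair j) (rcons r w)).
rewrite map_rcons last_rcons -map_rcons; split=> //.
elim: r a rL {walk} => [|b r IH] a /=; rewrite /inner_ok /noncollider_in nj /=.
  by rewrite !andbT.
by case/andP=> -> /IH.
Qed.

(** The arrowheads at the two ends of the segment are those of the edge, so
    that kept nodes keep their collider status when segments are glued. *)
Lemma lift_edge k u v : has_edge G k u v ->
  exists s r, [/\ is_walk D u (s :: r), (last s r).2 = v,
    head_at_source s.1 = head_at_source k,
    head_at_target (last s r).1 = head_at_target k &
    path (inner_ok (noncollider_in L)) s r].
Proof.
case: k => e.
- case/latent_dirP: e => uW vW [r ur rL].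
  by apply: (constant_segment (j := Fwd) _ rL); rewrite ?is_walk_fwd.
- case/latent_dirP: e => uW vW [r ur rL].
  apply: (constant_segment (j := Bwd) (r := rev r)); rewrite ?all_rev //.
  move: ur; rewrite is_walk_bwd -(rev_path (dir D)) belast_rcons last_rcons.
  by rewrite rev_cons revK.
case/and4P: e => _ _ _ /asboolP[s [p [t [/and4P[_ walk _ /eqP l] sB tF]]]].
rewrite all_inner /= => ok; exists s, (rcons p t); rewrite last_rcons sB tF.
split=> //; by move: l; rewrite /= unzip2_rcons last_rcons.
Qed.

(** Latent nodes only appear as non-colliders in the lift: hence the condition
    on [P].  The lift is in general a walk and not a path, because different
    edges may arise from segments that share latent nodes. *)
Lemma lift_walk (P : T -> bool -> bool) x q :
  (forall v, v \in L -> P v false) -> is_walk G x q -> sorted (inner_ok P) q ->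
  exists p, [/\ is_walk D x p, last x (unzip2 p) = last x (unzip2 q),
    is_causal p = is_causal q, sorted (inner_ok P) p &
    {subset unzip2 q <= unzip2 p} /\
    {subset unzip2 p <= [predU (unzip2 q) & L]}].
Proof.
move=> PL walk ok.
(* Gluing at a node requires knowing the mark that leaves it: hence the last
   clause of the induction. *)
suff [p [H1 H2 H3 H4 [H5 H6]]] : exists p, [/\ is_walk D x p,
    last x (unzip2 p) = last x (unzip2 q), is_causal p = is_causal q,
    sorted (inner_ok P) p & [/\ {subset unzip2 q <= unzip2 p},
    {subset unzip2 p <= [predU (unzip2 q) & L]} &
    omap (fun s => head_at_source s.1) (ohead p) =
    omap (fun s => head_at_source s.1) (ohead q)]] by exists p.
elim: q x walk ok => [|[k v] q IH] x /=; first by exists [::].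
case/andP=> e walk ok; case: (IH v walk (path_sorted ok)) => p [pw pl pc pok].
case=> qp pqL hpq; have [s [r [sw sl hs ht sr]]] := lift_edge e.
have nc : path (inner_ok (fun _ c => ~~ c)) s r.
  by apply: sub_path sr => a b /andP[].
have l' : last s.2 (unzip2 r) = v by rewrite /unzip2 last_map.
exists ((s :: r) ++ p); split.
- by rewrite is_walk_cat sw /= l'.
- by rewrite /= unzip2_cat last_cat l'.
- rewrite causal_cat pc (noncollider_chain_causal nc) /=.
  by rewrite !is_fwdE hs.
- rewrite /= cat_path; apply/andP; split.
    by apply: sub_path sr => a b /andP[/negPf]; rewrite /inner_ok => -> /PL.
  case: p q hpq pok ok {IH walk pw pl pc qp pqL} => [|a p] [|b q] //= [ab].
  move=> -> /andP[kb _]; rewrite andbT; move: kb.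
  by rewrite /inner_ok /collider /= sl ht ab.
have srE : unzip2 (s :: r) = rcons (unzip2 (belast s r)) v.
  by rewrite lastI unzip2_rcons sl.
have ncL : all [in L] (unzip2 (belast s r)).
  rewrite -path_source; by apply: sub_path sr => a b /andP[].
rewrite unzip2_cat srE; split.
- move=> w; rewrite inE mem_cat mem_rcons inE => /orP[->//|/qp ->].
  by rewrite !orbT.
- move=> w; rewrite mem_cat mem_rcons !inE -orbA => /or3P[->//|/(allP ncL)|/pqL].
    by rewrite inE => ->; rewrite orbT.
  by rewrite !inE => /orP[]->; rewrite !orbT.
by rewrite /= hs.
Qed.

(** A segment without colliders has no arrowhead at its start (and is directed
    forward), or none at its end (and is directed backward), or has both; these
    are the three kinds of edges of the projection. *)
Lemma project_edge u s r : u \in W -> (last s r).2 \in W ->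
  is_walk D u (s :: r) -> uniq (u :: unzip2 (s :: r)) ->
  path (inner_ok (noncollider_in L)) s r ->
  exists k, [/\ has_edge G k u (last s r).2,
    head_at_source k = head_at_source s.1 &
    head_at_target k = head_at_target (last s r).1].
Proof.
move=> uW vW walk un sr; case: (dagD) => _ nobid.
have nc : path (inner_ok (fun _ c => ~~ c)) s r.
  by apply: sub_path sr => a b /andP[].
have srE : unzip2 (s :: r) = rcons (unzip2 (belast s r)) (last s r).2.
  by rewrite lastI unzip2_rcons.
have ncL : all [in L] (unzip2 (belast s r)).
  rewrite -path_source; by apply: sub_path sr => a b /andP[].
have [hs|hs] := boolP (head_at_source s.1); last first.
  have caus : is_causal (s :: r) by rewrite noncollider_chain_causal // is_fwdE.
  have ht : head_at_target (last s r).1.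
    move: caus; rewrite /is_causal lastI all_rcons => /andP[+ _].
    by case: (last s r).1.
  exists Fwd; rewrite ht; split=> //.
  apply/latent_dirP; split=> //; exists (unzip2 (belast s r)) => //.
  by rewrite -srE; apply: causal_walk_path.
have [ht|ht] := boolP (head_at_target (last s r).1); last first.
  exists Bwd; split=> //.
  apply/latent_dirP; split=> //; exists (rev (unzip2 (belast s r))).
    have := walk; rewrite (noncollider_chain_bwd nc ht) is_walk_bwd srE.
    by rewrite -(rev_path (dir D)) last_rcons belast_rcons rev_cons.
  by rewrite all_rev.
exists Bi; split=> //; apply/and4P; split=> //.
  by move: un; rewrite srE /= mem_rcons inE negb_or => /andP[/andP[]].
have [sB tF] : s.1 = Bwd /\ (last s r).1 = Fwd.
  have noBi y q : is_walk D y q ->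
      all (fun a => if a.1 is Bi then false else true) q.
    elim: q y => //= -[k v] q IH y /andP[e /IH ->]; rewrite andbT.
    by case: k e => //= e; have := nobid y v; rewrite e.
  have := noBi _ _ walk; rewrite {1}lastI all_rcons => /andP[].
  have := noBi _ _ walk => /andP[]; clear -hs ht.
  by case: (s.1) hs; case: (last s r).1 ht.
case: (lastP r) sB tF sr walk un => [|r' t]; first by move=> /= ->.
rewrite !last_rcons => sB tF sr walk un.
apply/asboolP; exists s, r', t; split=> //.
  apply/and4P; split=> //; first exact: (subsetP WD).
  by rewrite /= unzip2_rcons last_rcons.
by rewrite all_inner.
Qed.

(** The condition on [P] says that latent nodes are not colliders; otherwise the
    segments between kept nodes would not give edges. *)
Lemma project_walk (P : T -> bool -> bool) x p :
  (forall v, v \in L -> P v true = false) ->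
  x \in W -> last x (unzip2 p) \in W -> is_walk D x p ->
  uniq (x :: unzip2 p) -> sorted (inner_ok P) p ->
  exists q, [/\ is_walk G x q, last x (unzip2 q) = last x (unzip2 p),
    is_causal q = is_causal p, sorted (inner_ok P) q &
    subseq (unzip2 q) (unzip2 p)].
Proof.
move=> PL xW lW walk un ok.
suff [q [H1 H2 H3 H4 [H5 _]]] : exists q, [/\ is_walk G x q,
    last x (unzip2 q) = last x (unzip2 p),
    is_causal q = is_causal p, sorted (inner_ok P) q &
    subseq (unzip2 q) (unzip2 p) /\
    omap (fun s => head_at_source s.1) (ohead q) =
    omap (fun s => head_at_source s.1) (ohead p)] by exists q.
have [n] := ubnP (size p).
elim: n p x xW lW walk un ok => // n IH [|s p] x xW lW walk un ok.
  by exists [::].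
rewrite ltnS => sz.
have [|r [p' [pE vW rW]]] := @split_first _ [in W] s p.
  by rewrite -last_map.
subst p; set v := (last s r).2 in vW.
move: walk; rewrite -cat_cons is_walk_cat => /andP[sw pw].
have lv : last s.2 (unzip2 r) = v by rewrite /unzip2 last_map.
rewrite /= lv in pw.
have up : uniq (v :: unzip2 p').
  move: un; rewrite -cat_cons unzip2_cat.
  rewrite (lastI s r) unzip2_rcons -/v cat_rcons.
  by rewrite -cat_cons cat_uniq => /and3P[].
have us : uniq (x :: unzip2 (s :: r)).
  by move: un; rewrite -cat_cons unzip2_cat -cat_cons cat_uniq => /and3P[].
have rnodes := walk_nodes (proj1 dagD) sw.
have srL : path (inner_ok (noncollider_in L)) s r.
  move: ok; rewrite /= cat_path => /andP[ok _].
  have: all [in nodes D] (unzip2 (belast s r)).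
    by move: rnodes; rewrite lastI unzip2_rcons all_rcons => /andP[].
  rewrite -path_source => rD; clear - PL ok rW rD.
  elim: r s ok rW rD => //= t r IHr s.
  move=> /andP[o1 o2] /andP[w1 w2] /andP[n1 n2]; rewrite IHr // andbT.
  have sL : s.2 \in L by rewrite inE w1.
  rewrite /inner_ok /noncollider_in sL andbT; apply/negP => c.
  by move: o1; rewrite /inner_ok c PL.
have [k [e hs ht]] := project_edge xW vW sw us srL.
have nc : path (inner_ok (fun _ c => ~~ c)) s r.
  by apply: sub_path srL => a b /andP[].
have [|||q [qw ql qc qok [qp hqp]]] := IH p' v vW _ pw up.
- by move: lW; rewrite -cat_cons unzip2_cat last_cat /= lv.
- by move: ok; rewrite /= cat_path => /andP[_ /path_sorted].
- by apply: leq_trans sz; rewrite /= size_cat ltnS leq_addl.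
exists ((k, v) :: q); split.
- by rewrite /= e.
- by rewrite /= unzip2_cat last_cat lv.
- rewrite causal_cat (noncollider_chain_causal nc) -qc /=.
  by rewrite !is_fwdE hs.
- case: q p' hqp qok ok {IH qw ql qc qp up un lW pw sz}
    => [|a q] [|b p'] //= [ab] ->.
  rewrite andbT cat_path /= => /and3P[_ + _].
  by rewrite /inner_ok /collider /= ht ab.
split; last by rewrite /= hs.
rewrite unzip2_cat (lastI s r) unzip2_rcons -/v cat_rcons.
apply: (@subseq_trans _ (v :: unzip2 p')); first by rewrite /= eqxx.
exact: suffix_subseq.
Qed.

(** For the converse direction, a directed path is projected as a path without
    colliders. *)
Lemma latent_connect u v : u \in W -> v \in W ->
  connect (dir G) u v = connect (dir D) u v.
Proof.
move=> uW vW; apply/idP/idP.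
  by apply: connect_sub => a b; apply: dir_latent_connect.
case/connectP=> l ul vE; case: (dagD) => [[_ _ _ acD] _].
have [|||||q [qw ql qc _ _]] :=
  @project_walk (fun _ c => ~~ c) u (map (pair Fwd) l) _ uW.
- by [].
- by rewrite unzip2_steps -vE.
- by rewrite is_walk_fwd.
- by rewrite unzip2_steps; apply: acyclic_path_uniq ul.
- by case: l {ul vE} => //= a l; elim: l a => //= b l ->.
apply/connectP; exists (unzip2 q); last by rewrite ql unzip2_steps.
by apply: causal_walk_path; rewrite // qc causal_of_steps.
Qed.

Lemma latent_an (Z : {set T}) v : Z \subset W -> v \in W ->
  (v \in an G Z) = (v \in an D Z).
Proof.
move=> ZW vW; rewrite !inE; apply: eq_existsb => z.
by case: (boolP (z \in Z)) => //= /(subsetP ZW) zW; rewrite latent_connect.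
Qed.

Lemma latent_an_sub (Z : {set T}) v : v \in an G Z -> v \in an D Z.
Proof.
rewrite !inE => /exists_inP[z zZ vz]; apply/exists_inP; exists z => //.
by apply: connect_sub vz => a b; apply: dir_latent_connect.
Qed.

(** A causal path lifts to a causal walk, which stays proper because the added
    nodes are latent and X is kept. *)
Lemma latent_cn_sub (X Y : {set T}) : X \subset W -> cn G X Y \subset cn D X Y.
Proof.
move=> XW; apply/subsetP => v; rewrite !inE => /andP[vX /asboolP].
case=> x [y [p [/and4P[/and4P[_ walk _ /eqP l] xX yY pX] caus vp]]].
have vxp : v \in unzip2 p.
  by move: vp vX; rewrite inE => /orP[/eqP->|]; rewrite ?xX.
have [||q [qw ql qc _ [pq qpL]]] := @lift_walk (fun _ _ => true) x p _ walk.
- by [].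
- by case: (p) => //= a r; elim: r a => //= b r IH a; apply: IH.
have vD : v \in cn D X Y.
  apply: (causal_walk_cn (proj1 dagD) xX _ qw); rewrite ?qc ?ql ?l //.
  - by apply: (subsetP WD); apply: (subsetP XW).
  - apply/allP => w /qpL; rewrite !inE => /orP[/(allP pX)//|/andP[wW _]].
    by apply: contra wW; apply: (subsetP XW).
  exact: pq.
by move: vD; rewrite !inE vX.
Qed.

Lemma latent_forb_sub (X Y : {set T}) : X \subset W ->
  forb G X Y \subset forb D X Y.
Proof.
move=> XW; apply: setSU; apply/subsetP => v; rewrite !inE.
case/exists_inP=> c /(subsetP (latent_cn_sub Y XW)) cD cv.
apply/exists_inP; exists c => //.
by apply: connect_sub cv => a b; apply: dir_latent_connect.
Qed.

End Projection.

(** * The forbidden projection *)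
Theorem proposition8 (T : finType) (D : mixed_graph T) (X Y Z : {set T}) :
  is_dag D ->
  X \subset nodes D -> Y \subset nodes D -> Z \subset nodes D ->
  [disjoint X & Y] -> [disjoint X & Z] -> [disjoint Y & Z] ->
  (valid_adjustment_set D X Y Z <->
   valid_adjustment_set (forbidden_projection D X Y) X Y Z).
Proof.
move=> dagD XD YD ZD XY XZ YZ.
rewrite /forbidden_projection.
set W := nodes D :\: forb D X Y :|: X :|: Y; set G := latent_projection D W.
have WD : W \subset nodes D by rewrite !subUset XD YD subsetDl.
have XW : X \subset W by apply/subsetP => v vX; rewrite !inE vX !orbT.
have YW : Y \subset W by apply/subsetP => v vY; rewrite !inE vY !orbT.
have latent v : v \in nodes D :\: W ->
    [/\ v \in de D (cn D X Y), v \in forb D X Y & v \notin X].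
  rewrite in_setD in_setU in_setU in_setD => /andP[+ vD].
  rewrite vD andbT !negb_or negbK => /andP[/andP[vF vX] _]; split=> //.
  by move: vF; rewrite in_setU (negPf vX) orbF.
split=> -[ZN ZXY ZF blk].
- have ZW : Z \subset W.
    by apply/subsetP => z zZ; rewrite 2!in_setU in_setD (disjointFr ZF zZ)
       (subsetP ZD).
  split=> //; first exact: disjointWr (latent_forb_sub dagD WD Y XW) ZF.
  move=> x y q /and4P[/and4P[_ walk _ /eqP l] xX yY qX] nc.
  (* An open path of the projection is lifted to D and its loops are cut. *)
  apply: contraT; rewrite unblockedE => ok.
  have [v /latent[_ vF _]||p [pw pl pc pok [_ pqL]]] :=
    lift_walk dagD WD (P := open_at D Z) _ walk.
  + by rewrite /open_at (contraL _ vF) // => /(disjointFr ZF)->.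
  + apply: sub_sorted ok => s t; rewrite /inner_ok /open_at.
    by case: ifP => // _; apply: latent_an_sub.
  have pX : all [predC X] (unzip2 p).
    by apply/allP => v /pqL; rewrite inE => /orP[/(allP qX)//|]; case/latent.
  rewrite -pl in l; rewrite -pc in nc.
  have [p' [pp' nc' op']] := open_walk_shorten (proj1 dagD) ZF xX
    (subsetP XD _ xX) pw l yY pX nc pok.
  by rewrite (blk _ _ _ pp' nc') in op'.
(* A kept node outside [X] and [Y] is not forbidden. *)
have ZFD : [disjoint Z & forb D X Y].
  apply/pred0P => z /=; apply/negP => /andP[zZ zF].
  have := subsetP ZN _ zZ; rewrite inE inE in_setD zF /= -in_setU.
  by rewrite (disjointFr ZXY zZ).
split=> // x y p /and4P[/and4P[xD walk un /eqP l] xX yY pX] nc.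
(* An open path of D is projected; latent nodes, not being ancestors of Z, are
   not colliders on it. *)
apply: contraT; rewrite unblockedE => ok.
have [v /latent[vde _ _]|||q [qw ql qc qok qp]] :=
  project_walk dagD WD (P := open_at D Z) _ (subsetP XW _ xX) _ walk un.
- exact/negbTE/(de_an_disjoint ZFD).
- by rewrite l (subsetP YW).
- exact: ok.
have := blk x y q; rewrite qc => /(_ _ nc) /=.
have -> : is_proper_path G X Y x y q.
  apply/and4P; split=> //; last first.
    by apply/allP => v /(mem_subseq qp) /(allP pX).
  apply/and4P; split=> //; [exact: (subsetP XW)| |by rewrite ql l].
  by apply: subseq_uniq un; rewrite /= eqxx.
move=> /(_ isT); apply: contraLR => _; rewrite unblockedE.
apply: (@sub_in_sorted _ [pred s | s.2 \in W]) qok; last first.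
  by have := latent_walk_nodes qw; rewrite all_map.
move=> s t sW _; rewrite /inner_ok /open_at.
by case: ifP => // _; rewrite latent_an.
Qed.
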